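(* There is a family of sofic shifts $\{X_n\}$ such that, for all sufficiently large $n$, the minimal deterministic presentation of $X_n$ has at most $n$ vertices and the minimal synchronizing deterministic presentation of $X_n$ has $2^{\Omega(n)}$ vertices.
   Context: A labeled graph has finite vertex and edge sets, edges with initial/terminal vertices and labels from a finite alphabet; $X_G$ is the set of label sequences of bi-infinite paths in $G$. A sofic shift is a set of the form $X_G$. A presentation of $X$ is an essential labeled graph $G$ (every vertex has an incoming and an outgoing edge) with $X_G=X$; it is deterministic if no vertex has two outgoing edges with the same label, and synchronizing if for every vertex $r$ there is a word $w$ such that the set of end vertices of all paths labeled $w$ equals $\{r\}$. A minimal (synchronizing) deterministic presentation of $X$ is a (synchronizing) deterministic presentation of $X$ with the fewest vertices among all such presentations. *)

(* Defs.v *)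
From HB Require Import structures.
From mathcomp Require Import all_boot all_order all_algebra.
From mathcomp Require Import classical_sets.

Set Implicit Arguments.
Unset Strict Implicit.
Unset Printing Implicit Defensive.

Import GRing.Theory.
Local Open Scope ring_scope.
Local Open Scope classical_set_scope.

(* Multigraphs: parallel edges and self-loops are allowed. *)
Record lgraph (A : finType) := LGraph {
  vertex : finType;
  edge : finType;
  src : edge -> vertex;
  tgt : edge -> vertex;
  lab : edge -> A }.

Section LabeledGraphs.
Variable A : finType.
Implicit Types (G H : lgraph A) (X : set (int -> A)) (P : lgraph A -> Prop).

Definition biinfinite_path G (p : int -> edge G) : Prop :=
  forall i, tgt (p i) = src (p (i + 1)).

Definition shift_of G : set (int -> A) :=
  [set x | exists2 p : int -> edge G,
     biinfinite_path p & forall i, x i = lab (p i)].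

Definition sofic X : Prop := exists G, shift_of G = X.

Definition essential G : Prop :=
  forall v : vertex G, (exists e, tgt e = v) /\ (exists e, src e = v).

Definition presentation X G : Prop := essential G /\ shift_of G = X.

Definition deterministic G : Prop :=
  forall e f : edge G, src e = src f -> lab e = lab f -> e = f.

Fixpoint walk G (v : vertex G) (p : seq (edge G)) (u : vertex G) : Prop :=
  if p is e :: p' then src e = v /\ walk (tgt e) p' u else v = u.

(* The empty word labels the paths of length zero, one at each vertex. *)
Definition end_vertices G (w : seq A) : set (vertex G) :=
  [set u | exists v (p : seq (edge G)), walk v p u /\ map (@lab A G) p = w].

Definition synchronizing G : Prop :=
  forall r : vertex G, exists w : seq A, end_vertices w = [set r] :> set (vertex G).

Definition det_presentation X G : Prop := presentation X G /\ deterministic G.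

Definition sync_det_presentation X G : Prop :=
  [/\ presentation X G, synchronizing G & deterministic G].

Definition fewest_vertices P G : Prop :=
  P G /\ forall H, P H -> (#|vertex G| <= #|vertex H|)%N.

Definition minimal_det_presentation X G : Prop :=
  fewest_vertices (det_presentation X) G.

Definition minimal_sync_det_presentation X G : Prop :=
  fewest_vertices (sync_det_presentation X) G.

End LabeledGraphs.

(* Main.v *)
(* For m : nat take the one-step shift with letters d, a_S (S a subset of 'I_m) and b_j
   (j in option 'I_m) whose points are d^oo, b_j^oo and d^oo a_S b_j^oo with j = None or
   j = Some i, i in S.  A deterministic presentation can guess j in advance: two
   states per j are enough.  In a synchronizing one, a vertex emitting a_S is
   synchronized by a power of d, which remembers nothing about j; the vertex reached
   by a_S therefore emits exactly the b_j compatible with S, hence it determines S,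
   and there are at least 2^m vertices. *)
Require Import Defs.
From HB Require Import structures.
From mathcomp Require Import all_boot all_order all_algebra.
From mathcomp Require Import all_classical all_reals all_analysis.
From mathcomp Require Import zify lra.

Set Implicit Arguments.
Unset Strict Implicit.
Unset Printing Implicit Defensive.

Import Order.TTheory GRing.Theory Num.Theory.
Import numFieldNormedType.Exports.
Local Open Scope classical_set_scope.
Local Open Scope ring_scope.

(** Vertex counts are well-ordered, so one presentation yields a minimal one and bounds its size
    from above. *)
Lemma fewest_vertices_exists (A : finType) (P : lgraph A -> Prop) (G : lgraph A) :
  P G -> exists2 H, fewest_vertices P H & (#|vertex H| <= #|vertex G|)%N.
Proof.
move=> PG.
pose Q k := `[< exists2 H, P H & #|vertex H| = k >].
have exQ : exists k, Q k by exists #|vertex G|; apply/asboolP; exists G.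
case: (ex_minnP exQ) => k /asboolP [H PH cH] minH.
have leH K : P K -> (#|vertex H| <= #|vertex K|)%N.
  by move=> PK; rewrite cH; apply: minH; apply/asboolP; exists K.
by exists H; [split | exact: leH].
Qed.

(** * One-step shifts and their synchronizing presentations *)

Definition one_step_shift (A : finType) (ok : rel A) : set (int -> A) :=
  [set x | forall i, ok (x i) (x (i + 1))].

Section OneStepPresentation.
Variables (A : finType) (ok : rel A).
Hypothesis ok_pred : forall x, exists y, ok y x.
Hypothesis ok_succ : forall x, exists y, ok x y.

Definition last_letter_graph : lgraph A :=
  @LGraph A A {xy : A * A | ok xy.1 xy.2}
    (fun e => (sval e).1) (fun e => (sval e).2) (fun e => (sval e).2).

(** A state records the last letter read, so the one-letter word [[:: r]] synchronizes the state
    [r]. *)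
Lemma last_letter_graph_presentation :
  sync_det_presentation (one_step_shift ok) last_letter_graph.
Proof.
split; first split.
- move=> v; split.
    by have [u uv] := ok_pred v; exists (exist _ (u, v) uv).
  by have [u vu] := ok_succ v; exists (exist _ (v, u) vu).
- apply/seteqP; split => [x [p pP xE] i|x xP].
    have := svalP (p (i + 1)).
    by rewrite !xE /=; have /= -> := pP i.
  have okx i : ok (x (i - 1), x i).1 (x (i - 1), x i).2.
    by have := xP (i - 1); rewrite subrK.
  exists (fun i => exist _ (x (i - 1), x i) (okx i)) => // i /=.
  by rewrite addrK.
- move=> r; exists [:: r]; apply/seteqP; split => [u|u ->].
    by case=> v [[|e [|f p]]] /= [] // [_ <-] [<-].
  have [u' uu'] := ok_pred r.
  by exists u', [:: exist _ (u', r) uu'].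
- move=> [[x y] xy] [[x' y'] xy'] /= xx' yy'.
  by apply: val_inj; rewrite /= xx' yy'.
Qed.

End OneStepPresentation.

(** * Paths in essential graphs *)

Section EssentialGraphs.
Variables (A : finType) (G : lgraph A).

Lemma essential_extend (e f : edge G) : essential G -> tgt e = src f ->
  exists2 p : int -> edge G, biinfinite_path p & p 0 = e /\ p 1 = f.
Proof.
move=> essG ef.
have /choice [pre preP] v : exists e : edge G, tgt e = v by case: (essG v).
have /choice [suc sucP] v : exists e : edge G, src e = v by case: (essG v).
pose fwd := fun e' : edge G => suc (tgt e').
pose bwd := fun e' : edge G => pre (src e').
(* [Negz n] stands for [-(n + 1)], whence [n.+1] backward steps from [e], the edge at time 0. *)
exists (fun i => match i with
                 | Posz 0 => e
                 | Posz n.+1 => iter n fwd f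
                 | Negz n => iter n.+1 bwd e
                 end) => // -[[|n]|[|n]] //.
- have -> : Posz n.+1 + 1 = Posz n.+2 by lia.
  by rewrite /= sucP.
- by rewrite /= preP.
- have -> : Negz n.+1 + 1 = Negz n by lia.
  by rewrite [in LHS]/= preP.
Qed.

(** Two consecutive edges lie on a bi-infinite path, whose label sequence is a point of the
    shift. *)
Lemma presentation_ok (ok : rel A) (e f : edge G) :
  presentation (one_step_shift ok) G -> tgt e = src f -> ok (lab e) (lab f).
Proof.
move=> [essG GX] ef.
have [p pP [p0 p1]] := essential_extend essG ef.
have : shift_of G (fun i => lab (p i)) by exists p.
by rewrite GX => /(_ 0) /=; rewrite add0r p0 p1.
Qed.

Lemma walk_rcons (v u : vertex G) p e :
  walk v (rcons p e) u <-> walk v p (src e) /\ tgt e = u.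
Proof.
elim: p v => [|f p IHp] v /=; first by split=> -[-> ->].
by rewrite IHp; split=> [[-> []]|[[-> ]]].
Qed.

Lemma walk_mkseq (p : int -> edge G) (i : int) k : biinfinite_path p ->
  walk (src (p i)) (mkseq (fun l : nat => p (i + l%:Z)) k) (src (p (i + k%:Z))).
Proof.
move=> pP; elim: k => [|k IHk]; first by rewrite /= addr0.
rewrite mkseqS; apply/walk_rcons; split=> //.
by rewrite pP; congr (src (p _)); lia.
Qed.

End EssentialGraphs.

(** * The shift and its small deterministic presentation *)

Section SetGuessingShift.
Variable m : nat.

Definition letter : finType := option ({set 'I_m} + option 'I_m)%type.

Definition d : letter := None.
Definition a (S : {set 'I_m}) : letter := Some (inl S).
Definition b (j : option 'I_m) : letter := Some (inr j).

(* [None] is compatible with every [S], including the empty set: each [a S] occurs. *)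
Definition compatible (S : {set 'I_m}) (j : option 'I_m) : bool :=
  if j is Some i then i \in S else true.

Definition follows : rel letter := fun x y =>
  match x, y with
  | None, None => true
  | None, Some (inl _) => true
  | Some (inl s), Some (inr j) => compatible s j
  | Some (inr j), Some (inr k) => j == k
  | _, _ => false
  end.

Definition guess_shift : set (int -> letter) := one_step_shift follows.

Lemma guess_shift_sync :
  sync_det_presentation guess_shift (last_letter_graph follows).
Proof.
apply: last_letter_graph_presentation => -[[S|j]|].
- by exists d.
- by exists (b j) => /=.
- by exists d.
- by exists (b None).
- by exists (b j) => /=.
- by exists d.
Qed.

Definition point S j : int -> letter :=
  fun i => if i < 0 then d else if i == 0 then a S else b j.

Lemma point_guess_shift S j : compatible S j -> guess_shift (point S j).
Proof.
move=> Sj i; rewrite /point.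
have [i0|i0|->] := ltgtP i 0; last by [].
  by case: ltgtP => // ?; lia.
by case: ltgtP => //= ?; first [exact: eqxx | lia].
Qed.

(** Once [b l] occurs it repeats forever, so the earlier of the two occurrences forces the later
    one. *)
Lemma guess_shift_b x (i i' : int) j k : guess_shift x ->
  x i = b j -> x i' = b k -> j = k.
Proof.
move=> xP.
have fwd (h : int) l (n : nat) : x h = b l -> x (h + n%:Z) = b l.
  move=> xh; elim: n => [|n IHn]; first by rewrite addr0.
  have := xP (h + n%:Z); rewrite IHn.
  have -> : h + n%:Z + 1 = h + n.+1%:Z by lia.
  by case: (x _) => [[|l']|] //= /eqP ->.
wlog le_ii' : i i' j k / i <= i'.
  move=> W xi xi'; case: (leP i i') => [/W|/ltW /W]; first exact.
  by move=> /(_ _ _ xi' xi).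
move=> /(fwd _ _ `|i' - i|%N).
have -> : i + `|i' - i|%N%:Z = i' by lia.
by move=> -> [].
Qed.

(* A state [(c, j)] has guessed [j]; [c] tells whether the letter [a S] has been read. *)
Definition guess_enabled (vx : (bool * option 'I_m) * letter) : bool :=
  match vx.2 with
  | None => ~~ vx.1.1
  | Some (inl s) => ~~ vx.1.1 && compatible s vx.1.2
  | Some (inr j) => vx.1.1 && (j == vx.1.2)
  end.

Definition guess_graph : lgraph letter :=
  @LGraph letter (bool * option 'I_m)%type {vx | guess_enabled vx}
    (fun e => (sval e).1) (fun e => ((sval e).2 != d, (sval e).1.2))
    (fun e => (sval e).2).

Lemma guess_graph_presentation : det_presentation guess_shift guess_graph.
Proof.
split; last first.
  move=> [[v x] vx] [[v' x'] vx'] /= vv' xx'.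
  by apply: val_inj; rewrite /= vv' xx'.
split.
  move=> [[] j].
    have bj : guess_enabled ((true, j), b j) by rewrite /guess_enabled /=.
    by split; exists (exist guess_enabled _ bj).
  have dj : guess_enabled ((false, j), d) by [].
  by split; exists (exist guess_enabled _ dj).
apply/seteqP; split => [x [p pP xE] i|x xP].
  rewrite !xE /=; move: (pP i) => /=.
  case: (p i) => -[[c j] y] /= cjy; case: (p _) => -[[c' j'] z] /= cjz [cE jE].
  subst c' j'; move: cjy cjz; rewrite /guess_enabled /=.
  case: y => [[S|k]|]; case: z => [[T|l]|] //=.
    by move=> /andP[_ ?] /eqP ->.
  by move=> /andP[_ /eqP ->] /eqP ->.
(* The right guess is the index of the [b] letters of [x]; without any, [x] contains no [a S]
   either, and [None] serves. *)
have [j jP] : exists j, forall i k, x i = b k -> k = j.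
  have [[i [j xi]]|nob] := pselect (exists i j, x i = b j).
    by exists j => i' k xi'; exact: guess_shift_b xP xi' xi.
  by exists None => i k xi; case: nob; exists i, k.
have en i : guess_enabled ((x (i - 1) != d, j), x i).
  have := xP (i - 1); have := xP i; have := jP i; have := jP (i + 1).
  rewrite subrK /guess_enabled /=.
  case: (x (i - 1)) => [[S|k]|]; case: (x i) => [[T|l]|] //=.
  - by move=> _ /(_ _ erefl) ->.
  - by move=> _ /(_ _ erefl) ->.
  (* When [a T] is read, the next letter is [b h] with [h] compatible with [T], and [h] is the guess
     [j]. *)
  - by case: (x (i + 1)) => [[U|h]|] //= /(_ _ erefl) ->.
exists (fun i => exist guess_enabled _ (en i)) => // i /=.
by rewrite addrK.
Qed.

Lemma card_guess_graph : #|vertex guess_graph| = (2 * m.+1)%N.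
Proof. by rewrite card_prod card_bool card_option card_ord. Qed.

(** * The exponential lower bound for synchronizing presentations *)

Section LowerBound.
Variable H : lgraph letter.
Hypothesis HP : sync_det_presentation guess_shift H.

Let H_pres : presentation guess_shift H := let: And3 h _ _ := HP in h.
Let H_sync : synchronizing H := let: And3 _ h _ := HP in h.
Let H_det : deterministic H := let: And3 _ _ h := HP in h.

Lemma word_before_a (v : vertex H) p (e : edge H) S :
  walk v p (src e) -> lab e = a S -> map (@lab _ H) p = nseq (size p) d.
Proof.
(* The weaker condition that [d] may precede [lab e] passes to the preceding edge, since only [d]
   can precede [d] or some [a S]. *)
move=> vpe eS; have : follows d (lab e) by rewrite eS.
elim/last_ind: p e vpe {eS} => [//|p f IHp] e.
move=> /walk_rcons [vpf fe] de.
have fd : lab f = d.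
  have := presentation_ok H_pres fe; move: de.
  by case: (lab e) => [[]|] //=; case: (lab f) => [[]|].
by rewrite map_rcons size_rcons fd (IHp f) ?fd // -cats1 -addn1 nseqD.
Qed.

Lemma path_of_point S j : compatible S j ->
  exists2 p : int -> edge H, biinfinite_path p & forall i, point S j i = lab (p i).
Proof. by move=> /point_guess_shift; rewrite -H_pres.2. Qed.

(** The word synchronizing [src e] is a power of [d]. A path of [point S j] reads it just before
    time 0, hence is at [src e] at time 0; determinism makes its next edge [e], and [b j]
    follows. *)
Lemma b_after_a (e : edge H) S j : lab e = a S -> compatible S j ->
  exists2 f : edge H, src f = tgt e & lab f = b j.
Proof.
move=> eS Sj; have [w wE] := H_sync (src e).
have : end_vertices (G := H) w (src e) by rewrite wE.
case=> v [q [vqe qw]]; have wd := word_before_a vqe eS.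
have [p pP pE] := path_of_point Sj.
have : end_vertices (G := H) w (src (p 0)).
  exists (src (p (- (size q)%:Z))).
  exists (mkseq (fun l : nat => p (- (size q)%:Z + l%:Z)) (size q)); split.
    by have := walk_mkseq (- (size q)%:Z) (size q) pP; rewrite addNr.
  rewrite -qw wd; apply: (@eq_from_nth _ d).
    by rewrite size_map size_mkseq size_nseq.
  rewrite size_map size_mkseq => i iq.
  rewrite (nth_map (p 0)) ?size_mkseq // nth_mkseq // -pE nth_nseq iq /point.
  by rewrite ifT //; lia.
rewrite wE => /= p0e.
have -> : e = p 0 by apply: H_det; rewrite ?p0e // -pE eS.
exists (p 1); last by rewrite -pE.
by rewrite pP.
Qed.

Lemma card_sync_guess_shift : (2 ^ m <= #|vertex H|)%N.
Proof.
have /choice [e eP] (S : {set 'I_m}) : exists e : edge H, lab e = a S.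
  have [p _ pE] := @path_of_point S None isT.
  by exists (p 0); rewrite -pE.
(* For [i] in [S], the common target emits [b (Some i)], which may then follow [a T]; so [i] lies in
   [T]. *)
have sub S T : tgt (e S) = tgt (e T) -> S \subset T.
  move=> eST; apply/fintype.subsetP => i iS.
  have [f fe fi] := @b_after_a (e S) S (Some i) (eP S) iS.
  have := presentation_ok H_pres (etrans (esym eST) (esym fe)).
  by rewrite eP fi.
have inj : injective (fun S => tgt (e S)).
  by move=> S T eST; apply/eqP; rewrite finset.eqEsubset !sub.
have := leq_card _ inj.
by rewrite -[#|{set _}|]cardsT -powersetT card_powerset cardsT card_ord.
Qed.

End LowerBound.

End SetGuessingShift.

Theorem theorem5p5 (R : realType) :
  exists (A : nat -> finType) (X : forall n : nat, set (int -> A n)),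
    (forall n : nat, sofic (X n)) /\
    exists2 c : R, 0 < c &
      \forall n \near \oo,
        (exists2 G : lgraph (A n),
           minimal_det_presentation (X n) G & (#|vertex G| <= n)%N) /\
        (exists2 H : lgraph (A n),
           minimal_sync_det_presentation (X n) H &
           2 `^ (c * n%:R) <= #|vertex H|%:R).
Proof.
(* Chosen so that [2 * (m n).+1 <= n] as soon as [n >= 2]. *)
pose m n := (n %/ 2).-1.
exists (fun n => letter (m n)), (fun n => @guess_shift (m n)); split.
  by move=> n; exists (guess_graph (m n)); have [[_]] := guess_graph_presentation (m n).
(* For [n >= 4] one has [n <= 8 * m n], so [2 ^ m n] dominates the power of exponent [n / 8]. *)
exists 8^-1; first by rewrite invr_gt0.
exists 4%N => // n /= n4; split.
  have [G Gmin leG] := fewest_vertices_exists (guess_graph_presentation (m n)).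
  exists G => //; apply: leq_trans leG _.
  by rewrite card_guess_graph /m; lia.
have [H Hmin _] := fewest_vertices_exists (guess_shift_sync (m n)).
exists H => //.
have leH := card_sync_guess_shift Hmin.1.
apply: (@le_trans _ _ ((2 ^ m n)%N%:R)); last by rewrite ler_nat.
rewrite natrX -powR_mulrn // ler_powR ?ler1n //.
have : (n%:R : R) <= (8 * m n)%:R by rewrite ler_nat /m; lia.
by rewrite natrM; lra.
Qed.
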